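(* Let $d$ be a bounded distance on $\mathcal{S}^{q-1}$ and assume that $d$ is continuous (if $d=d_\delta$ is a rotation-invariant distance, $d_\delta(\theta,\psi)=\delta(\theta'\psi)$ with $\delta:[-1,1]\to\mathbb{R}^+$, then this is equivalent to assuming that $\delta$ is continuous on $[-1,1]$). Let $H$ be a probability distribution on $\mathcal{S}^{q-1}$. Then: (i) the mapping $\theta\mapsto D_d(\theta,H)$ is continuous on $\mathcal{S}^{q-1}$; (ii) there exists $\theta_d(H)\in\mathcal{S}^{q-1}$ such that $D_d(\theta_d(H),H)=\sup_{\theta\in\mathcal{S}^{q-1}}D_d(\theta,H)$.
   Context: Let $q\ge 2$ and $\mathcal{S}^{q-1}=\{x\in\mathbb{R}^q: x'x=1\}$, where $'$ denotes transpose; $\mathbb{R}^+=[0,\infty)$. A distance $d$ on $\mathcal{S}^{q-1}$ is a metric on this set; continuity of $d$ is with respect to the usual (Euclidean) topology on $\mathcal{S}^{q-1}$. A distance is rotation-invariant if $d(O\theta,O\psi)=d(\theta,\psi)$ for all $\theta,\psi\in\mathcal{S}^{q-1}$ and all $q\times q$ orthogonal matrices $O$; any such distance is of the form $d_\delta(\theta,\psi)=\delta(\theta'\psi)$ for some $\delta:[-1,1]\to\mathbb{R}^+$. For a bounded distance $d$ put $d^{\rm sup}=\sup\{d(\theta,\psi):\theta,\psi\in\mathcal{S}^{q-1}\}$. For a (Borel probability) distribution $H$ on $\mathcal{S}^{q-1}$, the directional $d$-depth of $\theta\in\mathcal{S}^{q-1}$ with respect to $H$ is $D_d(\theta,H)=d^{\rm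 sup}-E_H[d(\theta,W)]$, where $E_H$ is expectation when $W$ has distribution $H$. *)

(* Defs.v *)
From HB Require Import structures.
From mathcomp Require Import all_boot all_order all_algebra.
From mathcomp Require Import all_classical all_reals all_analysis.

Set Implicit Arguments.
Unset Strict Implicit.
Unset Printing Implicit Defensive.

Import Order.TTheory GRing.Theory Num.Theory.
Import numFieldNormedType.Exports.

Local Open Scope classical_set_scope.
Local Open Scope ring_scope.

Definition dotp (R : realType) (q : nat) (x y : 'cV[R]_q) : R :=
  (x^T *m y) 0 0.

Definition sphere_set (R : realType) (q : nat) : set 'cV[R]_q :=
  [set x | dotp x x = 1].

(* The sphere of R^q as a type. The argument [hq] makes it nonempty, hence
   pointed, as the library requires of every measurable type. *)
Definition sphere (R : realType) (q : nat) (hq : (2 <= q)%N) : Type :=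
  set_type (@sphere_set R q).

Arguments sphere : clear implicits.
Arguments sphere R {q} hq.

Section SphereInstances.
Context (R : realType) (q : nat) (hq : (2 <= q)%N).

Let e : 'cV[R]_q := delta_mx (Ordinal (ltnW hq)) 0.

Let sphere_e : e \in @sphere_set R q.
Proof.
rewrite inE /sphere_set /dotp /e /= trmx_delta mul_delta_mx mxE !eqxx; done.
Qed.

HB.instance Definition _ :=
  PseudoMetric.copy (sphere R hq) (set_type (@sphere_set R q)).
HB.instance Definition _ := isPointed.Build (sphere R hq) (SigSub sphere_e).

Definition sphere_val (x : sphere R hq) : 'cV[R]_q := set_val x.

Lemma dotp_mulmx (O : 'M[R]_q) (x y : 'cV[R]_q) :
  O^T *m O = 1%:M -> dotp (O *m x) (O *m y) = dotp x y.
Proof. by move=> hO; rewrite /dotp trmx_mul mulmxA -(mulmxA x^T) hO mulmx1. Qed.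

Lemma sphere_mulmx_subproof (O : 'M[R]_q) (hO : O^T *m O = 1%:M)
  (x : sphere R hq) : O *m sphere_val x \in @sphere_set R q.
Proof. by rewrite inE /sphere_set /= dotp_mulmx //; by move: (valP x); rewrite inE. Qed.

Definition sphere_mulmx (O : 'M[R]_q) (hO : O^T *m O = 1%:M)
  (x : sphere R hq) : sphere R hq := SigSub (sphere_mulmx_subproof hO x).

Definition borel_sphere := g_sigma_algebraType (@open (sphere R hq)).

(* Not the library's [metricType], whose topology is by definition the one
   induced by the distance: [d] is a priori unrelated to the topology of the
   sphere. *)
Record is_distance (d : sphere R hq -> sphere R hq -> R) : Prop := {
  distance_ge0 : forall x y, 0 <= d x y ;
  distance_eq0 : forall x y, d x y = 0 <-> x = y ;
  distance_sym : forall x y, d x y = d y x ;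
  distance_triangle : forall x y z, d x z <= d x y + d y z
}.

Definition distance_values (d : sphere R hq -> sphere R hq -> R) : set R :=
  [set r | exists x y, r = d x y].

Definition bounded_distance (d : sphere R hq -> sphere R hq -> R) : Prop :=
  is_distance d /\ has_ubound (distance_values d).

Definition dsup (d : sphere R hq -> sphere R hq -> R) : R :=
  sup (distance_values d).

Definition continuous_distance (d : sphere R hq -> sphere R hq -> R) : Prop :=
  continuous (fun p : sphere R hq * sphere R hq => d p.1 p.2).

Definition rotation_invariant (d : sphere R hq -> sphere R hq -> R) : Prop :=
  forall (O : 'M[R]_q) (hO : O^T *m O = 1%:M) (x y : sphere R hq),
    d (sphere_mulmx hO x) (sphere_mulmx hO y) = d x y.

Definition distance_of (delta : R -> R) (x y : sphere R hq) : R :=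
  delta (dotp (sphere_val x) (sphere_val y)).

(* [fine] turns the library's extended-real expectation into a real; it loses
   nothing when [d] is bounded and [d theta] is Borel. *)
Definition depth (d : sphere R hq -> sphere R hq -> R)
    (H : probability borel_sphere R) (theta : sphere R hq) : R :=
  dsup d - fine 'E_H[ d theta ].

End SphereInstances.

Arguments distance_of {R q} hq delta x y.

(* Main.v *)
Require Import Defs.
From HB Require Import structures.
From mathcomp Require Import all_boot all_order all_algebra.
From mathcomp Require Import all_classical all_reals all_analysis.
From mathcomp Require Import measurable_realfun ring lra.

Set Implicit Arguments.
Unset Strict Implicit.
Unset Printing Implicit Defensive.

Import Order.TTheory GRing.Theory Num.Theory.
Import numFieldNormedType.Exports.

Local Open Scope classical_set_scope.
Local Open Scope ring_scope.

(** The depth is 1-Lipschitz for the distance itself: by the triangle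
    inequality, [|d x w - d y w| <= d x y] for every [w], and integrating in [w]
    against a probability gives [|D(x) - D(y)| <= d x y] ([depth_lipschitz]).
    When [d] is continuous, [d x y] tends to [d x x = 0] as [y] tends to [x] in
    the Euclidean topology, so the depth is continuous. Measurability and boundedness of [d x] serve only to make these
    integrals finite, hence linear. A continuous function on the sphere attains
    its maximum because the sphere is compact ([sphere_max]).

    For a distance [delta (x . y)], continuity of [delta] on [-1, 1] passes to
    the distance because the inner product is continuous and, by Cauchy-Schwarz,
    takes unit vectors into [-1, 1]. Conversely [delta] is recovered by
    restricting the distance to an arc: with two orthonormal vectors, which
    exist since [2 <= q], the half circle
    [t |-> t e0 + sqrt (1 - t^2) e1] depends continuously on [t] and its inner
    product with [e0] is [t], so that [delta t] is the distance from [e0] to the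
    point of parameter [t] ([dotp_arc1]). *)

(** * The inner product *)

Lemma dotpE (R : realType) (q : nat) (x y : 'cV[R]_q) :
  dotp x y = \sum_i x i 0 * y i 0.
Proof. by rewrite /dotp mxE; apply: eq_bigr => i _; rewrite mxE. Qed.

Lemma dotpC (R : realType) (q : nat) (x y : 'cV[R]_q) : dotp x y = dotp y x.
Proof. by rewrite !dotpE; apply: eq_bigr => i _; rewrite mulrC. Qed.

Lemma dotpDZr (R : realType) (q : nat) (u x y : 'cV[R]_q) (a b : R) :
  dotp u (a *: x + b *: y) = a * dotp u x + b * dotp u y.
Proof. by rewrite /dotp mulmxDr -!scalemxAr !mxE. Qed.

Lemma dotp_ge0 (R : realType) (q : nat) (x : 'cV[R]_q) : 0 <= dotp x x.
Proof. by rewrite dotpE; apply: sumr_ge0 => i _; rewrite -expr2 sqr_ge0. Qed.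

Lemma dotp_delta (R : realType) (q : nat) (i j : 'I_q) :
  dotp (delta_mx i 0 : 'cV[R]_q) (delta_mx j 0) = (i == j)%:R.
Proof.
by rewrite /dotp trmx_delta mul_delta_mx_cond; case: (i == j); rewrite mxE.
Qed.

(** Cauchy-Schwarz for unit vectors: [x + y] and [x - y] have squared norms
    [2 + 2 (x . y)] and [2 - 2 (x . y)]. *)
Lemma unit_dotp_itv (R : realType) (q : nat) (x y : 'cV[R]_q) :
  dotp x x = 1 -> dotp y y = 1 -> `[-1, 1]%classic (dotp x y).
Proof.
move=> hx hy; rewrite /= in_itv /=.
have := dotp_ge0 (1 *: x + 1 *: y); have := dotp_ge0 (1 *: x + (-1) *: y).
rewrite !dotpDZr !(dotpC _ x) !(dotpC _ y) !dotpDZr hx hy (dotpC y x).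
by move=> h1 h2; apply/andP; split; lra.
Qed.

Lemma unit_coord_itv (R : realType) (q : nat) (x : 'cV[R]_q) (i : 'I_q) :
  dotp x x = 1 -> `[-1, 1]%classic (x i 0).
Proof.
rewrite dotpE (bigD1 i) //= => hx; rewrite in_itv /=.
have h0 : 0 <= \sum_(j < q | j != i) x j 0 * x j 0.
  by apply: sumr_ge0 => j _; rewrite -expr2 sqr_ge0.
by apply/andP; split; nra.
Qed.

Lemma dotp_continuous (R : realType) (q : nat) (T : topologicalType)
  (f g : T -> 'cV[R]_q) : continuous f -> continuous g ->
  continuous (fun t => dotp (f t) (g t)).
Proof.
move=> cf cg t; under eq_fun do rewrite dotpE.
apply: cvg_big => [|i _]; first exact: add_continuous.
have cvg_coord (h : T -> 'cV[R]_q) : continuous h ->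
    h s i 0 @[s --> t] --> h t i 0.
  move=> ch; apply: (@continuous_comp _ _ _ h (fun M : 'cV[R]_q => M i 0)).
    exact: ch.
  exact: coord_continuous.
by apply: cvgM; exact: cvg_coord.
Qed.

(** * Compactness of the sphere *)

Lemma trmx_continuous (T : topologicalType) (m n : nat) :
  continuous (@trmx T m n).
Proof.
move=> M U [P MP PU]; exists (fun i j => P j i).
  by move=> i j; have := MP j i; rewrite mxE.
by move=> N NP; apply: PU => i j; rewrite mxE; exact: NP.
Qed.

(** The sphere is a closed subset of the cube [-1, 1]^q. The argument runs on
    row vectors, for which Tychonoff's theorem [rV_compact] is stated, and is
    carried over to column vectors by transposition. *)
Lemma sphere_set_compact (R : realType) (q : nat) : compact (@sphere_set R q).
Proof.
have -> : @sphere_set R q = trmx @` [set v : 'rV[R]_q | dotp v^T v^T = 1].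
  apply/seteqP; split => [x xS|_ [v vS <-] //].
  by exists x^T; rewrite /= trmxK.
apply: continuous_compact; first exact/continuous_subspaceT/trmx_continuous.
have cube_compact :
    compact [set v : 'rV[R]_q | forall i, v ord0 i \in `[-1, 1]].
  have segment_cpt (_ : 'I_q) := @segment_compact R (-1) 1.
  exact (rV_compact segment_cpt).
apply: (subclosed_compact _ cube_compact) => [|v /= vS i].
  apply: (@preimage_closed _ _ (fun v : 'rV[R]_q => dotp v^T v^T) [set 1]).
    by move=> v _; apply: dotp_continuous; exact: trmx_continuous.
  exact: closed_eq.
by have := unit_coord_itv i vS; rewrite mxE.
Qed.

Lemma dotp_sphere (R : realType) (q : nat) (hq : (2 <= q)%N)
  (x : sphere R hq) : dotp (sphere_val x) (sphere_val x) = 1.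
Proof. by have := set_valP x. Qed.

Lemma sphere_val_continuous (R : realType) (q : nat) (hq : (2 <= q)%N) :
  continuous (@sphere_val R q hq).
Proof. exact: initial_continuous. Qed.

Lemma continuous_to_sphere (R : realType) (q : nat) (hq : (2 <= q)%N)
  (T : topologicalType) (f : T -> sphere R hq) :
  continuous (fun t => sphere_val (f t)) -> continuous f.
Proof. exact: continuous_comp_initial. Qed.

(** Compactness is known for the sphere as a subset of R^q, so [f] is first
    extended to R^q (by an arbitrary value outside the sphere), which keeps it
    continuous within the sphere. *)
Lemma sphere_max (R : realType) (q : nat) (hq : (2 <= q)%N)
  (f : sphere R hq -> R) : continuous f -> exists x, forall y, f y <= f x.
Proof.
move=> /subspace_valL_continuousP cf.
have S0 : @sphere_set R q !=set0.
  by exists (sphere_val (point : sphere R hq)); exact: set_valP.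
have [c cS cmax] := compact_EVT_max S0 (@sphere_set_compact R q) cf.
have valLE (x : sphere R hq) : valL f (sphere_val x) = f x.
  exact: (congr1 (@^~ x) (valLK point f)).
exists (SigSub cS) => y; rewrite -!valLE.
exact/cmax/mem_set/set_valP.
Qed.

(** * Continuity of the depth *)

(** The Borel sets of R are generated by open intervals, whose preimages are
    open. *)
Lemma continuous_borel_measurable (R : realType) (q : nat) (hq : (2 <= q)%N)
  (f : sphere R hq -> R) : continuous f ->
  measurable_fun [set: borel_sphere R hq] (f : borel_sphere R hq -> R).
Proof.
move=> /continuousP cf; apply: (measurability _ (RGenOpens.measurableE R)).
move=> _ [_ [a [b ->] <-]]; rewrite setTI.
by apply: sub_sigma_algebra; apply: cf; exact: interval_open.
Qed.

Lemma distance_continuous_r (R : realType) (q : nat) (hq : (2 <= q)%N)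
  (d : sphere R hq -> sphere R hq -> R) (cd : continuous_distance d)
  (x : sphere R hq) : continuous (d x).
Proof.
move=> y; apply: (@continuous_comp _ _ _ (fun y => (x, y)) (fun p => d p.1 p.2)).
  apply: (@cvg_pair _ _ _ (nbhs y) (nbhs x) (nbhs y)).
    exact: cvg_cst.
  exact: cvg_id.
exact: cd.
Qed.

Lemma distance_integrable (R : realType) (q : nat) (hq : (2 <= q)%N)
  (d : sphere R hq -> sphere R hq -> R) (hd : bounded_distance d)
  (cd : continuous_distance d) (H : probability (borel_sphere R hq) R)
  (x : sphere R hq) : H.-integrable setT (EFin \o d x).
Proof.
apply: measurable_bounded_integrable => //.
- by rewrite ltey_eq; apply/orP; left; exact: fin_num_measure.
- by apply: continuous_borel_measurable; exact: distance_continuous_r.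
- have [M dM] := hd.2; exists M; split; first exact: num_real.
  move=> N MN y _ /=; rewrite ger0_norm ?(distance_ge0 hd.1)//.
  by apply: le_trans (ltW MN); apply: dM; exists x, y.
Qed.

(** The pointwise bound [|d y w - d x w| <= d x y] survives integration in [w]
    because [H] has total mass one. *)
Lemma depth_lipschitz (R : realType) (q : nat) (hq : (2 <= q)%N)
  (d : sphere R hq -> sphere R hq -> R) (hd : bounded_distance d)
  (cd : continuous_distance d) (H : probability (borel_sphere R hq) R)
  (x y : sphere R hq) : `|depth d H x - depth d H y| <= d x y.
Proof.
have -> : depth d H x - depth d H y = \int[H]_w d y w - \int[H]_w d x w.
  by rewrite /depth !unlock /Rintegral; ring.
have iB : H.-integrable setT (EFin \o (fun w => d y w - d x w)).
  apply: (@integrableB _ _ _ H setT _ (EFin \o d y) (EFin \o d x)) => //;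
  exact: distance_integrable.
rewrite -RintegralB //; try exact: distance_integrable.
apply: le_trans (le_normr_Rintegral _ iB) _ => //.
have -> : d x y = \int[H]_(w in setT) d x y.
  by rewrite Rintegral_cst// [X in fine X](probability_setT H) mulr1.
apply: le_Rintegral => //.
- exact: integrable_norm.
- exact: finite_measure_integrable_cst.
- move=> w _; rewrite ler_norml; apply/andP; split.
    by have := distance_triangle hd.1 x y w; lra.
  by have := distance_triangle hd.1 y x w; rewrite (distance_sym hd.1 y x); lra.
Qed.

Lemma depth_continuous (R : realType) (q : nat) (hq : (2 <= q)%N)
  (d : sphere R hq -> sphere R hq -> R) (hd : bounded_distance d)
  (cd : continuous_distance d) (H : probability (borel_sphere R hq) R) :
  continuous (depth d H).
Proof.
move=> x; apply/(@cvgrPdist_lt _ _ _ (nbhs x)) => e e0.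
have /(@cvgrPdist_lt _ _ _ (nbhs x)) /(_ e e0) :=
  @distance_continuous_r _ _ _ _ cd x x.
apply: (@filterS _ (nbhs x)) => y; rewrite ((distance_eq0 hd.1 x x).2 erefl).
rewrite sub0r normrN => dxy; apply: le_lt_trans (depth_lipschitz hd cd H x y) _.
by apply: le_lt_trans dxy; exact: ler_norm.
Qed.

(** * Distances that are functions of the inner product *)

Lemma continuous_comp_within (T U V : topologicalType) (A : set U)
  (f : T -> U) (g : U -> V) : continuous f -> (forall t, A (f t)) ->
  {within A, continuous g} -> continuous (g \o f).
Proof.
move=> cf Af /subspace_continuousP cg t W /= gW.
have /= := cf t _ (cg _ (Af t) _ gW).
rewrite !nbhs_simpl /=.
by apply: (@filterS _ (nbhs t)) => s; apply; exact: Af.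
Qed.

(** Clipping the parameter makes the arc below total: it stays on the sphere,
    and is continuous, on all of R. *)
Definition clip (R : realType) (t : R) : R := Num.max (-1) (Num.min 1 t).

Lemma clip_itv (R : realType) (t : R) : `[-1, 1]%classic (clip t).
Proof.
by rewrite /= in_itv /= /clip le_max lexx /= ge_max ge_min lexx /= andbT; lra.
Qed.

Lemma clip_id (R : realType) (t : R) : `[-1, 1]%classic t -> clip t = t.
Proof.
by rewrite /= in_itv /= => /andP[t1 t2]; rewrite /clip min_r // max_r.
Qed.

Lemma clip_continuous (R : realType) : continuous (@clip R).
Proof.
move=> t; apply: (@continuous_max R R (cst (-1)) (cst 1 \min id)).
  exact: cvg_cst.
by apply: continuous_min; [exact: cvg_cst|exact: cvg_id].
Qed.

(** A half great circle, parametrised by its first coordinate. *)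
Definition arc_vec (R : realType) (q : nat) (hq : (2 <= q)%N) (t : R) :
    'cV[R]_q :=
  clip t *: delta_mx (Ordinal (ltnW hq)) 0 +
  Num.sqrt (1 - clip t ^+ 2) *: delta_mx (Ordinal hq) 0.

Lemma dotp_arc (R : realType) (q : nat) (hq : (2 <= q)%N) (s t : R) :
  dotp (arc_vec hq s) (arc_vec hq t) =
  clip s * clip t + Num.sqrt (1 - clip s ^+ 2) * Num.sqrt (1 - clip t ^+ 2).
Proof.
rewrite /arc_vec dotpDZr !(dotpC _ (delta_mx _ _)) !dotpDZr !dotp_delta.
by rewrite !eqxx -!val_eqE /=; ring.
Qed.

Lemma arc_unit (R : realType) (q : nat) (hq : (2 <= q)%N) (t : R) :
  arc_vec hq t \in @sphere_set R q.
Proof.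
rewrite inE /sphere_set /= dotp_arc -!expr2 sqr_sqrtr ?subrKC//.
by have := clip_itv t; rewrite /= in_itv /= => /andP[h1 h2]; nra.
Qed.

Definition arc (R : realType) (q : nat) (hq : (2 <= q)%N) (t : R) :
  sphere R hq := SigSub (arc_unit hq t).

Lemma arc_continuous (R : realType) (q : nat) (hq : (2 <= q)%N) :
  continuous (@arc R q hq).
Proof.
apply: continuous_to_sphere => t; apply: cvgD.
  by apply: cvgZr_tmp; exact: clip_continuous.
apply: cvgZr_tmp.
apply: (@continuous_comp R R R (fun s => 1 - clip s ^+ 2) Num.sqrt);
  last exact: sqrt_continuous.
apply: cvgB; first exact: cvg_cst.
by apply: cvgM; exact: clip_continuous.
Qed.

Lemma dotp_arc1 (R : realType) (q : nat) (hq : (2 <= q)%N) (t : R) :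
  `[-1, 1]%classic t ->
  dotp (sphere_val (arc hq 1)) (sphere_val (arc hq t)) = t.
Proof.
move=> t11; rewrite [LHS](dotp_arc hq 1 t) (clip_id t11) clip_id; last first.
  by rewrite /= in_itv /= lexx andbT; lra.
by rewrite expr1n subrr sqrtr0 mul0r addr0 mul1r.
Qed.

(** On [-1, 1], [delta] is the distance from the endpoint of the arc to its
    running point; conversely the distance is [delta] composed with the inner
    product. *)
Lemma continuous_distance_ofP (R : realType) (q : nat) (hq : (2 <= q)%N)
  (delta : R -> R) :
  continuous_distance (distance_of hq delta) <->
  {within `[-1, 1], continuous delta}.
Proof.
split=> [cd|cdelta].
  apply: (@subspace_eq_continuous _ _ _
            (distance_of hq delta (arc hq 1) \o arc hq)).
    by move=> t /set_mem t11; rewrite /= /distance_of dotp_arc1.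
  apply: continuous_subspaceT => t; apply: continuous_comp.
    exact: arc_continuous.
  exact: distance_continuous_r.
have cdot : continuous (fun p : sphere R hq * sphere R hq =>
    dotp (sphere_val p.1) (sphere_val p.2)).
  apply: dotp_continuous => p.
    by apply: continuous_comp; [exact: cvg_fst|exact: sphere_val_continuous].
  by apply: continuous_comp; [exact: cvg_snd|exact: sphere_val_continuous].
apply: (continuous_comp_within cdot _ cdelta) => p.
exact: unit_dotp_itv (dotp_sphere _) (dotp_sphere _).
Qed.

(** * Continuity and maximum of the depth *)

Theorem theorem2 (R : realType) (q : nat) (hq : (2 <= q)%N)
    (d : sphere R hq -> sphere R hq -> R) (hd : bounded_distance d) :
  (forall delta : R -> R,
      (forall t, t \in `[-1, 1] -> 0 <= delta t) ->
      rotation_invariant d ->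
      d = distance_of hq delta ->
      (continuous_distance d <-> {within `[-1, 1], continuous delta})) /\
  (continuous_distance d ->
    forall H : probability (borel_sphere R hq) R,
      continuous (depth d H) /\
      exists theta : sphere R hq, depth d H theta = sup (range (depth d H))).
Proof.
split=> [delta _ _ ->|cd H]; first exact: continuous_distance_ofP.
have cD : continuous (depth d H) by exact: depth_continuous.
split => //.
have [x xmax] := sphere_max cD; exists x; apply/eqP; rewrite eq_le; apply/andP.
have ubD : ubound (range (depth d H)) (depth d H x) by move=> _ [y _ <-].
split; last by apply: ge_sup => //; exists (depth d H x), x.
by apply: ub_le_sup; [exists (depth d H x)|exists x].
Qed.
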